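(* Let $C,D\subseteq\mathbb{R}^n$ be convex sets, let $x\in C\cap D$, and let $T_a=T_a(C,D)$ be their affine joint supporting subspace. Then $$N_{C\cap D}(x)=N_{C\cap T_a}(x)+N_{D\cap T_a}(x),$$ where the sum on the right is the Minkowski sum.
   Context: For a convex set $C\subseteq\mathbb{R}^n$ and $x\in C$, $N_C(x)=\{y\in\mathbb{R}^n\mid \forall c\in C,\ \langle y,c-x\rangle\le 0\}$ is the normal cone ($N_C(x)=\emptyset$ if $x\notin C$). $A\pm B=\{a\pm b\mid a\in A,b\in B\}$. Faces: for $C\subseteq\mathbb{R}^n$ convex, a subset $F\subseteq C$ is a face of $C$ if for all $y,z\in C$, whenever the open segment $]y,z[ = [y,z]\setminus\{y,z\}$ meets $F$, both $y,z\in F$. For $S\subseteq C$, $F_C(S)$ denotes the smallest face of $C$ containing $S$; $F_C(x)=F_C(\{x\})$. Joint supporting subspace: for convex $C,D\subseteq\mathbb{R}^n$ with $C\cap D\neq\emptyset$, $T(C,D):=\operatorname{Span} F_{C-D}(0)$ (linear span) and $T_a(C,D):=T(C,D)+(C\cap D)$. *)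

(* Defs.v *)
From mathcomp Require Import all_boot all_order all_algebra.
From mathcomp Require Import boolp classical_sets reals convex.
Set Implicit Arguments.
Unset Strict Implicit.
Unset Printing Implicit Defensive.
Import Order.TTheory GRing.Theory Num.Theory.
Local Open Scope classical_set_scope.
Local Open Scope ring_scope.

Section Defs.
Context {R : realType} {n : nat}.
Implicit Types (A B C D F S : set 'rV[R]_n) (x y z u v : 'rV[R]_n).

Definition dotv u v : R := \sum_(i < n) u 0 i * v 0 i.

Definition minkowski_sum A B : set 'rV[R]_n := [set a + b | a in A & b in B].
Definition minkowski_diff A B : set 'rV[R]_n := [set a - b | a in A & b in B].

Definition normal_cone C x : set 'rV[R]_n :=
  [set y | C x /\ forall c, C c -> dotv y (c - x) <= 0].

Definition closed_segment y z : set 'rV[R]_n :=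
  [set (1 - t) *: y + t *: z | t in [set t : R | 0 <= t <= 1]].

(* Empty when y = z. *)
Definition open_segment y z : set 'rV[R]_n :=
  closed_segment y z `\` [set y; z].

(* A face need not be convex or nonempty. *)
Definition face C F : Prop :=
  F `<=` C /\
  forall y z, C y -> C z -> open_segment y z `&` F !=set0 -> F y /\ F z.

Definition smallest_face C S : set 'rV[R]_n := smallest (face C) S.

Definition linear_span S : set 'rV[R]_n :=
  smallest (fun V : set 'rV[R]_n => submod_closed [in V]) S.

(* The next two definitions are meaningful only when C and D intersect, i.e. when 0 is in
   C - D: otherwise no face of C - D contains 0 and the intersection defining
   smallest_face is the whole space. *)
Definition joint_supporting_subspace C D : set 'rV[R]_n :=
  linear_span (smallest_face (minkowski_diff C D) [set 0]).

Definition affine_joint_supporting_subspace C D : set 'rV[R]_n :=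
  minkowski_sum (joint_supporting_subspace C D) (C `&` D).

Lemma face_smallest_face C S : S `<=` C -> face C (smallest_face C S).
Proof.
move=> SC; split; first by apply: smallest_sub => //; split.
move=> y z Cy Cz [w [wyz Fw]]; split=> G GS;
  by have [] := GS.1.2 y z Cy Cz (ex_intro _ w (conj wyz (Fw G GS))).
Qed.

Lemma submod_closed_linear_span S : submod_closed [in linear_span S].
Proof.
split; first by rewrite inE => V [[V0 _] _]; rewrite inE in V0.
move=> a u v; rewrite !inE => Su Sv V [Vc SV]; apply/set_mem.
by apply: Vc.2; apply/mem_set; [apply: Su|apply: Sv].
Qed.

End Defs.

(* Main.v *)
Require Import Defs.
From mathcomp Require Import all_boot all_order all_algebra.
From mathcomp Require Import boolp classical_sets reals convex.
From mathcomp Require Import interval_inference ring lra.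
Import Order.TTheory GRing.Theory Num.Theory.
Local Open Scope classical_set_scope.
Local Open Scope ring_scope.

(** The inclusion from right to left holds because [Ta] contains [C `&` D].
    For the other inclusion, [normal_cone_setI] is a sum rule: if [A] and [B]
    are convex, contain [x], and the directions [b - a] generate a convex cone that is a linear subspace (that is, 0 lies in the
    relative interior of [A - B]), then normal vectors to [A `&` B] split.
    Splitting [y] means finding [u] with [dotv y (b - x) <= dotv u (b - a)]
    for all [a] in [A] and [b] in [B]: taking [b := x], then [a := x], this
    says that [u] is normal to [A] and [y - u] is normal to [B].  Such a [u] is
    a linear majorant of a superlinear relation, which [superlinear_majorant],
    a Hahn-Banach argument, provides: being normal to [A `&` B] says precisely
    that the values over the direction 0 are nonpositive, and the cone of
    directions being a subspace keeps the supremum over each direction finite.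

    It remains to see that [A := C `&` Ta] and [B := D `&` Ta] satisfy the
    hypothesis of the sum rule.  The joint supporting subspace [T] consists of
    the directions along which one can move from 0 inside [C - D] both ways
    ([span_smallest_face0]).  If [c - d] and [c' - d'] are opposite elements of
    [C - D], the midpoint of [c] and [c'] is also the midpoint of [d] and
    [d'], hence lies in [C `&` D]; this places all four points in [Ta].  So
    every vector of [T] is a positive multiple of some [d - c] with [c] and
    [d] in [Ta] ([joint_supporting_subspace_conic]), and conversely such differences
    lie in [T], which is closed under opposite. *)

(** * Convex combinations in row-vector spaces *)

Lemma convex_comb {R : realType} {n} {A : set 'rV[R]_n} {a b} {s t : R} :
  @convex_set R 'rV[R]_n A -> A a -> A b -> 0 <= s -> 0 <= t -> s + t = 1 ->
  A (s *: a + t *: b).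
Proof.
move=> cA Aa Ab s0 t0 st.
have s1 : s <= 1 by lra.
have := cA a b (Itv01 s0 s1) (mem_set Aa) (mem_set Ab).
have -> : t = 1 - s by lra.
by rewrite inE.
Qed.

Lemma convex_comb_weighted
    {R : realType} {n} {A : set 'rV[R]_n} {a b} {s t : R} :
  @convex_set R 'rV[R]_n A -> A a -> A b -> 0 < s -> 0 < t ->
  A ((s / (s + t)) *: a + (t / (s + t)) *: b).
Proof.
move=> cA Aa Ab s0 t0; have st0 : 0 < s + t by lra.
apply: convex_comb => //; try (by apply: divr_ge0; lra).
by rewrite -mulrDl divff// lt0r_neq0.
Qed.

Lemma convex_set_minkowski_diff {R : realType} {n} {C D : set 'rV[R]_n} :
  @convex_set R 'rV[R]_n C -> @convex_set R 'rV[R]_n D ->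
  @convex_set R 'rV[R]_n (minkowski_diff C D).
Proof.
move=> cC cD _ _ l /set_mem[c Cc [d Dd <-]] /set_mem[c' Cc' [d' Dd' <-]].
apply/mem_set; exists (conv l (c : convex_lmodType _) c').
  by apply/set_mem; apply: cC; apply/mem_set.
exists (conv l (d : convex_lmodType _) d').
  by apply/set_mem; apply: cD; apply/mem_set.
rewrite /conv /=; apply/rowP => i; rewrite !mxE; ring.
Qed.

Section Dotv.
Context {R : realType} {n : nat}.
Implicit Types u v w : 'rV[R]_n.

Lemma dotvDl u v w : dotv (u + v) w = dotv u w + dotv v w.
Proof. by rewrite -big_split; apply: eq_bigr => i _; rewrite !mxE mulrDl. Qed.

Lemma dotvDr w u v : dotv w (u + v) = dotv w u + dotv w v.
Proof. by rewrite -big_split; apply: eq_bigr => i _; rewrite !mxE mulrDr. Qed.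

Lemma dotvZr w (a : R) v : dotv w (a *: v) = a * dotv w v.
Proof. by rewrite mulr_sumr; apply: eq_bigr => i _; rewrite !mxE mulrCA. Qed.

Lemma dotvNl u v : dotv (- u) v = - dotv u v.
Proof. by rewrite -sumrN; apply: eq_bigr => i _; rewrite !mxE mulNr. Qed.

Lemma dotvNr w v : dotv w (- v) = - dotv w v.
Proof. by rewrite -scaleN1r dotvZr mulN1r. Qed.

Lemma dotv0 w : dotv w 0 = 0.
Proof. by rewrite -(scale0r 0) dotvZr mul0r. Qed.

End Dotv.

(** * Linear majorants of superlinear relations *)

Section Superlinear.
Context {R : realType} {n : nat}.
Implicit Types (P Q : 'rV[R]_n -> R -> Prop) (u v w : 'rV[R]_n).

(** The pairs [(v, r)] with [P v r] form a convex cone, to be thought of as a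
    set of lower bounds for a linear form: [P v r] demands the value at [v] to
    be at least [r].  Symmetry of the set of directions [v] makes it a linear
    subspace, and the last clause says that the demands on 0 are consistent. *)
Definition superlinear P : Prop :=
  [/\ P 0 0,
      forall s v r, 0 < s -> P v r -> P (s *: v) (s * r),
      forall v v' r r', P v r -> P v' r' -> P (v + v') (r + r'),
      forall v r, P v r -> exists r', P (- v) r' &
      forall r, P 0 r -> r <= 0].

(** The cone sum of [P] and the line through [(w, a)], which forces the value
    of a linear majorant at [w] to be exactly [a]. *)
Definition add_line P w (a : R) v r := exists t, P (v - t *: w) (r - t * a).

(** One step of the Hahn-Banach extension.  The demands [r] at [w] and [r'] at
    [- w] satisfy [r + r' <= 0] because they add up to a demand at 0, so the
    supremum of the former is finite and is consistent with both.  If there is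
    no demand at [w], there is none at any nonzero multiple of [w], and every
    value is consistent. *)
Lemma superlinear_add_line {P} w :
  superlinear P -> exists a, superlinear (add_line P w a).
Proof.
move=> [P00 PZ PD PN Ple].
suff [a Ha] : exists a, forall t r, P (- (t *: w)) (r - t * a) -> r <= 0.
  exists a; split.
  - by exists 0; rewrite scale0r mul0r !subr0.
  - move=> s v r s0 [t Pt]; exists (s * t).
    by rewrite -scalerA -scalerBr -mulrA -mulrBr; exact: PZ.
  - move=> v v' r r' [t Pt] [t' Pt']; exists (t + t').
    by rewrite scalerDl mulrDl !opprD !(addrACA _ _ (- _)); exact: PD.
  - move=> v r [t /PN[r' Pr']]; exists (r' - t * a), (- t).
    rewrite scaleNr opprK mulNr opprK subrK.
    by rewrite opprB addrC in Pr'.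
  - by move=> r [t]; rewrite sub0r; exact: Ha.
have [[e0 Pe0]|Pw] := pselect (exists r, P w r); last first.
  exists 0 => t r; rewrite mulr0 subr0.
  have [->|t0] := eqVneq t 0; first by rewrite scale0r oppr0; exact: Ple.
  move=> Pt; exfalso; apply: Pw.
  have [t_gt0|t_lt0|t_eq0] := ltgtP t 0; last by rewrite t_eq0 eqxx in t0.
    exists ((- t)^-1 * r).
    have -> : w = (- t)^-1 *: - (t *: w).
      by rewrite -scaleNr scalerA mulVf ?scale1r// oppr_eq0.
    by apply: PZ => //; rewrite invr_gt0; lra.
  have [r' Pr'] := PN _ _ Pt; exists (t^-1 * r').
  have -> : w = t^-1 *: - - (t *: w).
    by rewrite opprK scalerA mulVf ?scale1r.
  by apply: PZ => //; rewrite invr_gt0.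
have Ew r r' : P w r -> P (- w) r' -> r <= - r'.
  move=> Pr Pr'; have := PD _ _ _ _ Pr Pr'.
  by rewrite subrr => /Ple; lra.
have [f0 Pf0] := PN _ _ Pe0.
have E0 : [set r | P w r] !=set0 by exists e0.
have ubE : has_ubound [set r | P w r] by exists (- f0) => r /Ew; apply.
exists (sup [set r | P w r]) => t r; set a := sup _.
have [t_lt0|t_gt0|->] := ltgtP t 0; last first.
- by rewrite scale0r oppr0 mul0r subr0; exact: Ple.
- move=> /(PZ t^-1); rewrite invr_gt0 => /(_ t_gt0).
  rewrite scalerN scalerA mulVf ?gt_eqF// scale1r => Pt.
  have : a <= - (t^-1 * (r - t * a)) by apply: ge_sup => // e Pe; exact: Ew.
  rewrite mulrBr mulrA mulVf ?gt_eqF// mul1r => ha.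
  have : t^-1 * r <= 0 by lra.
  by rewrite pmulr_rle0 ?invr_gt0.
- move=> /(PZ (- t)^-1); rewrite invr_gt0 oppr_gt0 => /(_ t_lt0).
  rewrite -scaleNr scalerA mulVf ?oppr_eq0 ?lt_eqF// scale1r => Pt.
  have := ub_le_sup ubE Pt; rewrite -/a mulrBr mulrA invrN !mulNr.
  rewrite mulVf ?lt_eqF// => ha.
  have : t^-1 * r >= 0 by lra.
  by rewrite nmulr_rge0 ?invr_lt0.
Qed.

Lemma superlinear_add_lines {P} (ws : seq 'rV[R]_n) : superlinear P ->
  exists Q, [/\ superlinear Q, forall v r, P v r -> Q v r &
    forall w, w \in ws -> exists a, Q w a /\ Q (- w) (- a)].
Proof.
move=> sP; elim: ws => [|w ws [Q [sQ PQ Qws]]]; first by exists P; split.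
have [a sQa] := superlinear_add_line w sQ.
have QQa v r : Q v r -> add_line Q w a v r.
  by move=> Qvr; exists 0; rewrite scale0r mul0r !subr0.
exists (add_line Q w a); split=> // [v r /PQ /QQa//|w'].
rewrite inE => /orP[/eqP ->|/Qws[b [Qb QNb]]]; last first.
  by exists b; split; exact: QQa.
have [Q0 _ _ _ _] := sQ.
exists a; split; first by exists 1; rewrite scale1r mul1r !subrr.
by exists (- 1); rewrite scaleN1r mulN1r !opprK !addNr.
Qed.

(** Once the values on the canonical basis are fixed, linearity fixes the form
    [u]: the extended relation contains [(- v, - dotv u v)] for every [v], and
    adding this pair to [(v, r)] gives a demand [r - dotv u v] at 0. *)
Lemma superlinear_majorant {P} :
  superlinear P -> exists u, forall v r, P v r -> r <= dotv u v.
Proof.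
move=> sP.
have [Q [[Q0 QZ QD _ Qle] PQ Qe]] :=
  superlinear_add_lines [seq delta_mx 0 i | i <- enum 'I_n] sP.
have /choice[a Qa] i : exists a, Q (delta_mx 0 i) a /\ Q (- delta_mx 0 i) (- a).
  by apply: Qe; apply: map_f; rewrite mem_enum.
have QaZ i (c : R) : Q (c *: delta_mx 0 i) (c * a i).
  have [c0|c0|->] := ltgtP c 0; last by rewrite scale0r mul0r.
    rewrite -[c]opprK scaleNr mulNr -scalerN -mulrN.
    by apply: QZ; [rewrite oppr_gt0|exact: (Qa i).2].
  by apply: QZ => //; exact: (Qa i).1.
exists (\row_i a i) => v r /PQ Qvr.
have QN : Q (- v) (- dotv (\row_i a i) v).
  rewrite -dotvNr [in X in Q X _](row_sum_delta (- v)).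
  apply: (big_ind2 Q) => // [w w' s s'|i _]; first exact: QD.
  by rewrite [_ * (- v) 0 i]mulrC [X in _ * X]mxE; exact: QaZ.
by have := QD _ _ _ _ Qvr QN; rewrite subrr => /Qle; lra.
Qed.

End Superlinear.

(** * The joint supporting subspace *)

Section Lineality.
Context {R : realType} {n : nat}.
Implicit Types (K C D : set 'rV[R]_n) (u v w x : 'rV[R]_n).

Definition two_sided_directions K : set 'rV[R]_n :=
  [set v | exists2 s : R, 0 < s & K (s *: v) /\ K (- (s *: v))].

Lemma submod_closed_two_sided_directions K :
  @convex_set R 'rV[R]_n K -> K 0 ->
  submod_closed [in two_sided_directions K].
Proof.
move=> cK K0; split=> [|a u v].
  by rewrite inE; exists 1; rewrite ?scaler0 ?oppr0.
rewrite !inE => -[s s0 [Ku KNu]] [t t0 [Kv KNv]].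
have [|a0|->] := ltgtP a 0; last by rewrite scale0r add0r; exists t.
(* Weighting [t *: v] by [s], and [s *: u] up to sign by [|a| * t], yields a
   positive multiple of [a *: u + v]. *)
- move=> a0; exists (s * t / (s - a * t)).
    by rewrite divr_gt0 ?mulr_gt0// subr_gt0 (@lt_trans _ _ 0)// nmulr_rlt0.
  have b0 : 0 < - (a * t) by rewrite -mulNr mulr_gt0// oppr_gt0.
  have sb0 : s - a * t != 0 by apply: lt0r_neq0; lra.
  split; [have := convex_comb_weighted cK Kv KNu s0 b0
         |have := convex_comb_weighted cK KNv Ku s0 b0];
  congr (K _); apply/rowP => i; rewrite !mxE; by field.
- exists (s * t / (s + a * t)).
    by rewrite divr_gt0 ?mulr_gt0// addr_gt0// mulr_gt0.
  have b0 : 0 < a * t by rewrite mulr_gt0.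
  have sb0 : s + a * t != 0 by apply: lt0r_neq0; lra.
  split; [have := convex_comb_weighted cK Kv Ku s0 b0
         |have := convex_comb_weighted cK KNv KNu s0 b0];
  congr (K _); apply/rowP => i; rewrite !mxE; by field.
Qed.

(** If [w] is between [y] and [z] and one can move from 0 along [- w], then
    combining [- e w] with [z] so as to cancel the [z]-component of [w] gives
    a negative multiple of [y].  So does combining it with [y], for [z]. *)
Lemma face_reversible K : @convex_set R 'rV[R]_n K ->
  face K [set g | K g /\ exists2 e : R, 0 < e & K (- (e *: g))].
Proof.
move=> cK; split=> [g []//|y z Ky Kz].
move=> [w [[[t /andP[t0 t1] tw] wyz] [Kw [e e0 Kew]]]].
have {}t0 : 0 < t.
  rewrite lt_neqAle t0 andbT; apply/eqP => t00; apply: wyz; left.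
  by rewrite -tw -t00 subr0 scale1r scale0r addr0.
have {}t1 : 0 < 1 - t.
  rewrite subr_gt0 lt_neqAle t1 andbT; apply/eqP => t11; apply: wyz; right.
  by rewrite -tw t11 subrr scale1r scale0r add0r.
have et0 : 0 < e * t by rewrite mulr_gt0.
have et'0 : 0 < e * (1 - t) by rewrite mulr_gt0.
have n1 : 1 + e * t != 0 by apply: lt0r_neq0; lra.
have n2 : 1 + e * (1 - t) != 0 by apply: lt0r_neq0; lra.
split; split=> //.
  exists (e * (1 - t) / (1 + e * t)); first by rewrite divr_gt0//; lra.
  have := convex_comb_weighted cK Kew Kz ltr01 et0.
  congr (K _); rewrite -tw; apply/rowP => i; rewrite !mxE; by field.
exists (e * t / (1 + e * (1 - t))); first by rewrite divr_gt0//; lra.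
have := convex_comb_weighted cK Kew Ky ltr01 et'0.
congr (K _); rewrite -tw; apply/rowP => i; rewrite !mxE; by field.
Qed.

(** Two distinct opposite points have 0 in the open segment between them. *)
Lemma opposite_in_smallest_face K v : K v -> K (- v) ->
  smallest_face K [set 0] v.
Proof.
move=> Kv KNv F [[FK Fface] F0].
have {}F0 : F 0 by exact: F0.
have [->//|v0] := eqVneq v 0.
suff /(Fface v (- v) Kv KNv)[] : open_segment v (- v) `&` F !=set0 by [].
exists 0; split=> //; split.
  exists (2^-1); first by apply/andP; split; lra.
  by apply/rowP => i; rewrite !mxE; field.
by case=> /= /esym/eqP; rewrite ?oppr_eq0 (negPf v0).
Qed.

(** The smallest face at 0 lies in the face of [face_reversible], whose points
    are two-sided directions; conversely a positive multiple of a two-sided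
    direction lies in every face containing 0. *)
Lemma span_smallest_face0 K : @convex_set R 'rV[R]_n K -> K 0 ->
  linear_span (smallest_face K [set 0]) = two_sided_directions K.
Proof.
move=> cK K0; apply/seteqP; split.
  apply: smallest_sub; first exact: submod_closed_two_sided_directions.
  apply: (@subset_trans _
    [set g | K g /\ exists2 e : R, 0 < e & K (- (e *: g))]).
    apply: smallest_sub; first exact: face_reversible.
    by move=> _ ->; split=> //; exists 1; rewrite ?scaler0 ?oppr0.
  move=> g [Kg [e e0 KNg]].
  have ne : 1 + e != 0 by apply: lt0r_neq0; lra.
  exists (e / (1 + e)); first by rewrite divr_gt0//; lra.
  split; [have := convex_comb_weighted cK K0 Kg ltr01 e0
         |have := convex_comb_weighted cK KNg K0 ltr01 e0];
  congr (K _); apply/rowP => i; rewrite !mxE; by field.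
move=> v [s s0 [Kv KNv]].
have /mem_set Sv : linear_span (smallest_face K [set 0]) (s *: v).
  by apply: sub_gen_smallest; exact: opposite_in_smallest_face.
have [S0 SD] := submod_closed_linear_span (smallest_face K [set 0]).
have := SD s^-1 _ _ Sv S0.
by rewrite addr0 scalerA mulVf ?lt0r_neq0// scale1r inE.
Qed.

Lemma joint_supporting_subspaceE {C D x} :
  @convex_set R 'rV[R]_n C -> @convex_set R 'rV[R]_n D -> (C `&` D) x ->
  joint_supporting_subspace C D = two_sided_directions (minkowski_diff C D).
Proof.
move=> cC cD [Cx Dx]; apply: span_smallest_face0.
  exact: convex_set_minkowski_diff.
by exists x => //; exists x => //; rewrite subrr.
Qed.

(** The difference of two points of [C `&` D] lies in [C - D] in both
    orders, so adding all of [C `&` D] to the joint supporting subspace is the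
    same as translating it by a single point. *)
Lemma affine_joint_supporting_subspaceE {C D x} z :
  @convex_set R 'rV[R]_n C -> @convex_set R 'rV[R]_n D -> (C `&` D) x ->
  affine_joint_supporting_subspace C D z <->
  joint_supporting_subspace C D (z - x).
Proof.
move=> cC cD [Cx Dx]; split=> [[t Tt [m [Cm Dm] <-]]|Tz]; last first.
  by exists (z - x) => //; exists x => //; rewrite subrK.
have [_ /(_ 1 t (m - x))] :
    submod_closed [in joint_supporting_subspace C D].
  exact: submod_closed_linear_span.
rewrite scale1r addrA !inE; apply=> //.
rewrite (joint_supporting_subspaceE cC cD (conj Cx Dx)).
exists 1; rewrite // scale1r; split; first by exists m => //; exists x.
by exists x => //; exists m => //; rewrite opprB.
Qed.

(** The directions [d - c] remain plentiful after [C] and [D] are cut by [Ta]: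
    the points [c] and [d] that witness a two-sided direction are already in
    [Ta], because the segments from [c] and [d] to their counterparts for the
    opposite direction share a midpoint [m] of [C `&` D]. *)
Lemma joint_supporting_subspace_conic {C D x v} :
  @convex_set R 'rV[R]_n C -> @convex_set R 'rV[R]_n D -> (C `&` D) x ->
  let Ta := affine_joint_supporting_subspace C D in
  joint_supporting_subspace C D v ->
  exists s c d, [/\ 0 < s, (C `&` Ta) c, (D `&` Ta) d & v = s *: (d - c)].
Proof.
move=> cC cD CDx Ta; have TE := joint_supporting_subspaceE cC cD CDx.
rewrite TE => -[s s0 [[c' Cc' [d' Dd' sv]] [c Cc [d Dd Nsv]]]].
have sv0 : s != 0 by exact: lt0r_neq0.
have [h0 h1] : (0 <= 2^-1 :> R) /\ (2^-1 + 2^-1 = 1 :> R) by split; lra.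
pose m := 2^-1 *: c + 2^-1 *: c'.
have mE : m = 2^-1 *: d + 2^-1 *: d'.
  apply/rowP => i; rewrite !mxE.
  by move/rowP/(_ i): sv; move/rowP/(_ i): Nsv; rewrite !mxE; lra.
have Cm : C m by exact: convex_comb.
have Dm : D m by rewrite mE; exact: convex_comb.
have TaE z := affine_joint_supporting_subspaceE z cC cD (conj Cm Dm).
exists s^-1, c, d; split; first by rewrite invr_gt0.
- split=> //; apply/TaE; rewrite TE; exists 1; rewrite // scale1r.
  split; first by exists c => //; exists m.
  exists c' => //; exists m => //.
  by apply/rowP => i; rewrite !mxE; field.
- split=> //; apply/TaE; rewrite TE; exists 1; rewrite // scale1r.
  split; last by exists m => //; exists d => //; rewrite opprB.
  exists m => //; exists d' => //.
  by rewrite mE; apply/rowP => i; rewrite !mxE; field.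
- by rewrite -opprB Nsv opprK scalerA mulVf// scale1r.
Qed.

End Lineality.

(** * Normal cones of intersections *)

Section SumRule.
Context {R : realType} {n : nat}.
Implicit Types (A B : set 'rV[R]_n) (x y v : 'rV[R]_n).

(** The last hypothesis says that the cone generated by the differences
    [b - a] is symmetric, hence a subspace.  It is the qualification condition of
    the sum rule: for two tangent discs of the plane, the normal cone at their
    common point is the whole plane, while the sum is only a line. *)
Lemma normal_cone_setI A B x :
  @convex_set R 'rV[R]_n A -> @convex_set R 'rV[R]_n B -> (A `&` B) x ->
  (forall a b, A a -> B b ->
    exists s a' b', [/\ 0 < s, A a', B b' & - (b - a) = s *: (b' - a')]) ->
  normal_cone (A `&` B) x = minkowski_sum (normal_cone A x) (normal_cone B x).
Proof.
move=> cA cB [Ax Bx] sym; apply/seteqP; split=> [y [_ Hy]|]; last first.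
  move=> _ [y1 [_ H1] [y2 [_ H2] <-]]; split=> // c [Ac Bc].
  by rewrite dotvDl; have := H1 c Ac; have := H2 c Bc; lra.
(* The condition [dotv y (b - x) <= dotv u (b - a)] on [u], made positively
   homogeneous. *)
pose P v (r : R) := exists s a b,
  [/\ 0 < s, A a, B b, v = s *: (b - a) & r = s * dotv y (b - x)].
have sP : superlinear P.
  split.
  - by exists 1, x, x; split; rewrite ?subrr ?scaler0 ?dotv0 ?mulr0.
  - move=> t v r t0 [s [a [b [s0 Aa Bb -> ->]]]].
    by exists (t * s), a, b; rewrite mulr_gt0// scalerA mulrA.
  - move=> v v' r r' [s [a [b [s0 Aa Bb -> ->]]]] [t [c [d [t0 Ac Bd -> ->]]]].
    have st0 : s + t != 0 by apply: lt0r_neq0; lra.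
    exists (s + t), ((s / (s + t)) *: a + (t / (s + t)) *: c),
      ((s / (s + t)) *: b + (t / (s + t)) *: d); split.
    + lra.
    + exact: convex_comb_weighted.
    + exact: convex_comb_weighted.
    + by apply/rowP => i; rewrite !mxE; field.
    + by rewrite !dotvDr !dotvZr dotvNr; field.
  - move=> v r [s [a [b [s0 Aa Bb -> _]]]].
    have [t [a' [b' [t0 Aa' Bb' ab]]]] := sym a b Aa Bb.
    exists (s * t * dotv y (b' - x)), (s * t), a', b'.
    by split=> //; [rewrite mulr_gt0|rewrite -scalerN ab scalerA].
  - move=> r [s [a [b [s0 Aa Bb /esym/eqP + ->]]]].
    rewrite scaler_eq0 (gt_eqF s0) subr_eq0 /= => /eqP ba.
    by rewrite pmulr_rle0//; apply: Hy; split; rewrite // ba.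
have [u Hu] := superlinear_majorant sP.
have Hab a b : A a -> B b -> dotv y (b - x) <= dotv u (b - a).
  by move=> Aa Bb; apply: Hu; exists 1, a, b; rewrite scale1r mul1r.
exists u.
  split=> // a Aa; have := Hab a x Aa Bx.
  by rewrite subrr dotv0 -opprB dotvNr; lra.
exists (y - u); last by rewrite addrC subrK.
by split=> // b Bb; have := Hab x b Ax Bb; rewrite dotvDl dotvNl; lra.
Qed.

End SumRule.

Theorem corollary5p2 (R : realType) (n : nat) (C D : set 'rV[R]_n)
    (hC : @convex_set R 'rV[R]_n C) (hD : @convex_set R 'rV[R]_n D)
    (x : 'rV[R]_n) (hx : (C `&` D) x) :
  let Ta := affine_joint_supporting_subspace C D in
  normal_cone (C `&` D) x =
  minkowski_sum (normal_cone (C `&` Ta) x) (normal_cone (D `&` Ta) x).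
Proof.
move=> Ta.
have TaE z := affine_joint_supporting_subspaceE z hC hD hx.
have [T0 TL] : joint_supporting_subspace C D 0 /\
    forall a u v, joint_supporting_subspace C D u ->
      joint_supporting_subspace C D v ->
      joint_supporting_subspace C D (a *: u + v).
  have [T0 TL] := submod_closed_linear_span
    (smallest_face (minkowski_diff C D) [set 0]).
  split=> [|a u v Tu Tv]; first exact/set_mem.
  exact/set_mem/(TL a u v (mem_set Tu) (mem_set Tv)).
have subTa : C `&` D `<=` Ta.
  by move=> m CDm; exists 0; [exact: T0|exists m; rewrite ?add0r].
have cTa : @convex_set R 'rV[R]_n Ta.
  move=> u v l /set_mem/TaE Tu /set_mem/TaE Tv; apply/mem_set/TaE.
  have := TL (1 - l%:num) _ _ Tv (TL l%:num _ _ Tu T0).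
  congr (joint_supporting_subspace C D _); rewrite /conv /= /unstable.onem.
  by apply/rowP => i; rewrite !mxE; ring.
have cI A : @convex_set R 'rV[R]_n A -> @convex_set R 'rV[R]_n (A `&` Ta).
  move=> cA u v l /set_mem[Au Tu] /set_mem[Av Tv]; apply/mem_set.
  by split; apply/set_mem; [apply: cA|apply: cTa]; exact/mem_set.
rewrite -(setIidl subTa) -{1}(setIid Ta) setIACA.
have [Cx Dx] := hx; have Tax := subTa _ hx.
apply: normal_cone_setI => //; try exact: cI.
move=> a b [_ /TaE Tca] [_ /TaE Tdb].
apply: (joint_supporting_subspace_conic hC hD hx).
have := TL (- 1) _ _ Tdb (TL 1 _ _ Tca T0).
by congr (joint_supporting_subspace C D _); apply/rowP => i; rewrite !mxE; ring.
Qed.
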